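(* Let $G$ be a finite simple (unweighted) graph with adjacency matrix $A$, and suppose perfect state transfer occurs between two vertices of $G$. If $t$ is the minimum positive time at which this perfect state transfer occurs, then $t\le\pi/\sqrt{2}$.
   Context: Perfect state transfer between distinct vertices $i$ and $j$ at time $t>0$ means $\exp(\mathrm{i}tA)e_i=\gamma e_j$ for some $\gamma\in\mathbb{C}$ with $|\gamma|=1$, where $e_i,e_j$ are the standard basis vectors of the vertices. *)

(* Defs.v *)
From HB Require Import structures.
From mathcomp Require Import all_boot all_order all_algebra.
From mathcomp Require Import all_classical all_reals.
From mathcomp Require Import topology normedtype sequences trigo.
From mathcomp Require Import complex.
Set Implicit Arguments. Unset Strict Implicit. Unset Printing Implicit Defensive.
Import Order.TTheory GRing.Theory Num.Theory numFieldNormedType.Exports.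
Local Open Scope ring_scope.

Definition simple_graph (n : nat) (e : rel 'I_n) : Prop :=
  symmetric e /\ irreflexive e.

Definition adjmx (R : realType) (n : nat) (e : rel 'I_n) : 'M[R]_n :=
  \matrix_(u, v) (e u v)%:R.

Definition expcoef (R : realType) (t : R) (k : nat) : R[i] :=
  (('i%C * (t%:C)%C) ^+ k) / (k`!)%:R.

(* exp(i t A) for a real square matrix A, defined entrywise as the
   exponential power series  sum_k (i t)^k/k! A^k ; the complex series
   is summed through its real and imaginary parts (limits in R). *)
Definition expitA (R : realType) (n : nat) (A : 'M[R]_n) (t : R) : 'M[R[i]]_n :=
  \matrix_(u, v)
    Complex (limn (series (fun k : nat => @complex.Re R (expcoef t k) * (A ^+ k) u v : R) : R^nat))
            (limn (series (fun k : nat => @complex.Im R (expcoef t k) * (A ^+ k) u v : R) : R^nat)).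

Definition pst (R : realType) (n : nat) (A : 'M[R]_n) (a b : 'I_n) (t : R) : Prop :=
  exists gamma : R[i], `|gamma| = 1 /\
    forall u : 'I_n, expitA A t u a = gamma * (u == b)%:R.

(* Main.v *)
Require Import Defs.
From HB Require Import structures.
From mathcomp Require Import all_boot all_order all_algebra.
From mathcomp Require Import all_classical all_reals.
From mathcomp Require Import topology normedtype sequences trigo.
From mathcomp Require Import complex.
From mathcomp Require Import algC algnum.
From mathcomp Require Import ring lra zify.
Import Order.TTheory GRing.Theory Num.Theory numFieldNormedType.Exports.
Local Open Scope ring_scope.

Set Implicit Arguments. Unset Strict Implicit. Unset Printing Implicit Defensive.

(** Put [u = e_a + e_b] and [w = e_a - e_b], and let [S] and [T] be the sets of eigenvalues on
    whose eigenspaces [u] and [w] have a nonzero component. Perfect state transfer at time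
    [t] means that [exp (i t A)] multiplies [u] by a phase and [w] by the opposite phase,
    in other words that every difference of an element of [S] and an element of [T] is an
    odd multiple of [pi / t]. Let [g] be the gcd of these odd numbers and [c := g pi / t].
    Transfer then occurs at time [pi / c] already, so it suffices to show [2 <= c ^ 2].

    The number [c] is an algebraic integer, being an integral combination of eigenvalues,
    and [c ^ 2] is rational: the minimal polynomials of [u] and [w] relative to [A] are
    rational with roots [S] and [T], so the sum of all [(x - y) ^ 2], which is an integral
    multiple of [c ^ 2], is rational. Hence [c ^ 2] is a positive integer. It is even:
    since [u] and [w] agree modulo 2, the resultant [D] of the two minimal polynomials
    is divisible by 2 over the algebraic integers, whereas [D ^ 2], the product of all
    [(x - y) ^ 2], is [c ^ 2] to some power times an odd number. *)

Section AlgebraicIntegers.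

Variable K : numFieldType.
Implicit Types x : K.

Definition algint : {pred K} := [pred x | `[< integralOver (intr : int -> K) x >]].

Definition rat_num : {pred K} := [pred x | `[< exists q : rat, x = ratr q >]].

Lemma algintP x : reflect (integralOver (intr : int -> K) x) (x \in algint).
Proof. exact: asboolP. Qed.

Lemma rat_numP x : reflect (exists q : rat, x = ratr q) (x \in rat_num).
Proof. exact: asboolP. Qed.

Fact algint_subring : subring_closed algint.
Proof.
split=> [|x y /algintP ix /algintP iy|x y /algintP ix /algintP iy]; apply/algintP.
- exact: integral1.
- exact: integral_sub.
- exact: integral_mul.
Qed.

HB.instance Definition _ := GRing.isSubringClosed.Build K algint algint_subring.

Fact rat_num_divring : divring_closed rat_num.
Proof.
split=> [|x y /rat_numP[p ->] /rat_numP[q ->]|x y /rat_numP[p ->] /rat_numP[q ->]].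
- by apply/rat_numP; exists 1; rewrite rmorph1.
- by apply/rat_numP; exists (p - q); rewrite rmorphB.
- by apply/rat_numP; exists (p / q); rewrite fmorph_div.
Qed.

HB.instance Definition _ := GRing.isDivringClosed.Build K rat_num rat_num_divring.

Lemma rat_num_algint_int x :
  x \in rat_num -> x \in algint -> exists z : int, x = z%:~R.
Proof.
move=> /rat_numP[q ->] /algintP[p p_monic].
have pE (L : numFieldType) : map_poly (intr : int -> L) p =
    map_poly ratr (map_poly (intr : int -> rat) p).
  by rewrite -map_poly_comp; apply: eq_map_poly => z /=; rewrite ratr_int.
rewrite pE fmorph_root -(fmorph_root (ratr : rat -> algC)) -pE => pq.
have /intrP[z] : ratr q \in (Num.int : {pred algC}).
  apply: Cint_rat_Aint; first by apply/CratP; exists q.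
  apply: root_monic_Aint pq _ _; first exact: monic_map.
  by apply/polyOverP => i; rewrite coef_map /= rpred_int.
by rewrite -ratr_int => /fmorph_inj ->; exists z; rewrite ratr_int.
Qed.

End AlgebraicIntegers.

Arguments algint {K}.
Arguments rat_num {K}.

Section PolyOverSubring.

Variables (K : comNzRingType) (S : subringClosed K).
Implicit Types (c : K) (f h : {poly K}) (s t : seq K).

Definition bezout_over f h c :=
  exists U V, [/\ U \is a polyOver S, V \is a polyOver S & U * f + V * h = c%:P].

Lemma bezout_overC f h c : bezout_over f h c -> bezout_over h f c.
Proof. by case=> U [V [SU SV UV]]; exists V, U; rewrite addrC. Qed.

Lemma bezout_overM f1 f2 h c1 c2 : f1 \is a polyOver S -> c2 \in S ->
  bezout_over f1 h c1 -> bezout_over f2 h c2 -> bezout_over (f1 * f2) h (c1 * c2).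
Proof.
move=> Sf1 Sc2 [U1 [V1 [SU1 SV1 UV1]]] [U2 [V2 [SU2 SV2 UV2]]].
exists (U1 * U2), (V1 * c2%:P + U1 * f1 * V2); split; first exact: rpredM.
  by rewrite rpredD ?rpredM ?polyOverC.
by rewrite polyCM -UV1 -UV2; ring.
Qed.

Lemma bezout_over_prod h s (F : K -> {poly K}) (c : K -> K) :
  {in s, forall x, [/\ F x \is a polyOver S, c x \in S & bezout_over (F x) h (c x)]} ->
  bezout_over (\prod_(x <- s) F x) h (\prod_(x <- s) c x).
Proof.
elim: s => [|x s IH] bezout_F.
  by rewrite !big_nil; exists 1, 0; rewrite rpred0 rpred1; split=> //; ring.
have tail_F : {in s, forall y, [/\ F y \is a polyOver S, c y \in S & bezout_over (F y) h (c y)]}.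
  by move=> y ys; apply: bezout_F; rewrite inE ys orbT.
have [SFx _ bezout_x] := bezout_F x (mem_head _ _).
rewrite !big_cons; apply: bezout_overM => //; last exact: IH.
by rewrite big_seq rpred_prod // => y /tail_F[].
Qed.

Lemma prod_XsubC_bezout_over s t : {subset s <= S} -> {subset t <= S} ->
  bezout_over (\prod_(x <- s) ('X - x%:P)) (\prod_(y <- t) ('X - y%:P))
              (\prod_(x <- s) \prod_(y <- t) (x - y)).
Proof.
move=> sS tS; apply: bezout_over_prod => x /sS Sx; split; first by rewrite polyOverXsubC.
  by rewrite big_seq rpred_prod // => y /tS Sy; rewrite rpredB.
apply/bezout_overC/bezout_over_prod => y /tS Sy.
split; rewrite ?polyOverXsubC ?rpredB //.
by exists 1, (-1); rewrite rpredN !rpred1 polyCB; split=> //; ring.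
Qed.

(* Multiplying by 'X and 'X^2 shifts the two coefficients below the leading one to the index
   [size s], so that short sequences need no special treatment. *)
Lemma prod_XsubC_top_coefs s (F := \prod_(x <- s) ('X - x%:P)) :
  ('X * F)`_(size s) = - \sum_(x <- s) x /\
  ('X^2 * F)`_(size s) *+ 2 = (\sum_(x <- s) x) ^+ 2 - \sum_(x <- s) x ^+ 2.
Proof.
rewrite {}/F; elim: s => [|c s [IH_sum IH_sqr]] /=.
  by rewrite !big_nil !mulr1 coefX coefXn /=; split; ring.
have lead_coef1 : (\prod_(x <- s) ('X - x%:P))`_(size s) = 1.
  have /monicP := monic_prod_XsubC s xpredT id.
  by rewrite lead_coefE size_prod_XsubC.
rewrite !big_cons; move: lead_coef1 IH_sum IH_sqr.
set F := \prod_(x <- s) _ => lead_coef1 IH_sum IH_sqr; split.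
  by rewrite coefXM /= mulrBl coefB IH_sum coefCM lead_coef1; ring.
have -> : 'X^2 * (('X - c%:P) * F) = 'X * (('X^2 * F) - c%:P * ('X * F)) by ring.
by rewrite coefXM /= coefB coefCM mulrnBl IH_sqr IH_sum; ring.
Qed.

Lemma power_sums_rpred s : \prod_(x <- s) ('X - x%:P) \is a polyOver S ->
  \sum_(x <- s) x \in S /\ \sum_(x <- s) x ^+ 2 \in S.
Proof.
move=> SF; have [sumE sqrE] := prod_XsubC_top_coefs s.
have coefS (k : nat) : ('X^k * \prod_(x <- s) ('X - x%:P))`_(size s) \in S.
  by apply/polyOverP; rewrite rpredM ?rpredX ?polyOverX.
have sumS : \sum_(x <- s) x \in S by rewrite -rpredN -sumE (coefS 1%N).
split=> //; rewrite -[X in X \in S](subKr ((\sum_(x <- s) x) ^+ 2)) -sqrE.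
by rewrite rpredB ?rpredX ?rpredMn.
Qed.

Lemma sum_sqr_differences_rpred s t :
  \prod_(x <- s) ('X - x%:P) \is a polyOver S ->
  \prod_(y <- t) ('X - y%:P) \is a polyOver S ->
  \sum_(x <- s) \sum_(y <- t) (x - y) ^+ 2 \in S.
Proof.
move=> /power_sums_rpred[S_s S_s2] /power_sums_rpred[S_t S_t2].
suff -> : \sum_(x <- s) \sum_(y <- t) (x - y) ^+ 2 =
    (\sum_(x <- s) x ^+ 2) *+ size t - (\sum_(x <- s) x) * (\sum_(y <- t) y) *+ 2 +
    (\sum_(y <- t) y ^+ 2) *+ size s.
  by rewrite rpredD ?rpredB ?rpredMn ?rpredM.
under eq_bigr => x _.
  under eq_bigr do rewrite sqrrB.
  rewrite big_split sumrB /= big_const_seq count_predT iter_addr_0 sumrMnl -mulr_sumr.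
  over.
rewrite big_split sumrB /= big_const_seq count_predT iter_addr_0.
by rewrite !sumrMnl mulr_suml.
Qed.

End PolyOverSubring.

Lemma horner_mxOver (R : comNzRingType) (S : subringClosed R) n (A : 'M[R]_n.+1) p :
  A \is a mxOver S -> p \is a polyOver S -> horner_mx A p \is a mxOver S.
Proof.
move=> SA /polyOverP Sp; rewrite -[p]coefK poly_def rmorph_sum rpred_sum // => i _.
by rewrite /= horner_mxZ rmorphXn /= horner_mx_X mxOverZ ?rpredX.
Qed.

Lemma symmetric_diagonalizable (R : rcfType) n (A : 'M[R]_n.+1) :
  A^T = A -> diagonalizable A.
Proof.
move=> symA; pose f := real_complex R; pose B := map_mx f A.
have B_real : B \is a mxOver Num.real.
  by apply/mxOverP => i j; rewrite mxE; apply/complex_realP; exists (A i j).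
have B_herm : B \is hermsymmx.
  apply: realsym_hermsym => //; apply/is_hermitianmxP.
  by rewrite expr0 scale1r map_mx_id // /B map_trmx symA.
have /mxOverP D_real := hermitian_spectral_diag_real B_herm.
have /orthomx_spectralP B_diag := hermitian_normalmx B_herm.
pose rs := undup [seq complex.Re (spectral_diag B 0 i) | i <- enum 'I_n.+1].
apply/diagonalizableP; exists rs; first exact: undup_uniq.
rewrite -(dvdp_map f) -mxminpoly_map -/B B_diag -conjVmx ?spectral_unit //.
rewrite mxminpoly_uconj ?unitmx_inv ?spectral_unit // mxminpoly_diag map_prod_XsubC.
apply: uniq_roots_dvdp; last by rewrite uniq_rootsE undup_uniq.
apply/allP => z; rewrite mem_undup => /mapP[i _ ->].
rewrite -(big_map f xpredT (fun x => 'X - x%:P)) root_prod_XsubC.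
apply/mapP; exists (complex.Re (spectral_diag B 0 i)); last by rewrite /f RRe_real.
by rewrite mem_undup; apply: (map_f (fun i => complex.Re _)); rewrite mem_enum.
Qed.

(* The coefficients of [g] solve a linear system over [F] of full rank, whose rows are the
   first [deg g] iterates of [v] under [A]. *)
Lemma vec_minpoly_map (F K : fieldType) (f : {rmorphism F -> K}) n
    (A : 'M[F]_n.+1) (v : 'cV[F]_n.+1) (g : {poly K}) :
  g \is monic ->
  (forall q, (horner_mx (map_mx f A) q *m map_mx f v == 0) = (g %| q)) ->
  exists p : {poly F}, g = map_poly f p.
Proof.
move=> g_monic annihilator; pose k := (size g).-1.
have size_g : size g = k.+1 by rewrite prednK // size_poly_gt0 monic_neq0.
pose krylov : 'M[F]_(k, n.+1) := \matrix_(i < k) (A ^+ i *m v)^T.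
have krylovE (c : 'rV[K]_k) :
    c *m map_mx f krylov = (horner_mx (map_mx f A) (rVpoly c) *m map_mx f v)^T.
  rewrite mulmx_sum_row [rVpoly c]poly_def linear_sum /= mulmx_suml linear_sum.
  apply: eq_bigr => i _; rewrite valK /= linearZ /= -scalemxAl linearZ /=.
  by rewrite rmorphXn /= horner_mx_X -map_row rowK -rmorphXn -map_mxM map_trmx.
have krylov_free : row_free (map_mx f krylov).
  apply: inj_row_free => c; rewrite krylovE => /eqP; rewrite trmx_eq0 annihilator.
  move=> g_dvd; rewrite -[c]rVpolyK (_ : rVpoly c = 0) ?linear0 //; apply/eqP.
  by apply: contraTT g_dvd => c0; rewrite gtNdvdp // size_g ltnS size_poly.
pose r := 'X^k - g.
have size_r : (size r <= k)%N.
  apply/leq_sizeP => j; rewrite coefB coefXn leq_eqVlt => /orP[/eqP <-|kj].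
    by rewrite eqxx -[k]/(k.+1.-1) -size_g -lead_coefE (monicP g_monic) subrr.
  by rewrite gtn_eqF // nth_default ?subrr // size_g.
have rE : poly_rV r = map_mx f ((A ^+ k *m v)^T *m pinvmx krylov).
  rewrite map_mxM map_pinvmx -[LHS](mulmxKp krylov_free) krylovE poly_rV_K //.
  have /eqP gv0 : horner_mx (map_mx f A) g *m map_mx f v == 0 by rewrite annihilator.
  by rewrite rmorphB /= rmorphXn /= horner_mx_X mulmxBl gv0 subr0 -rmorphXn -map_trmx map_mxM.
exists ('X^k - rVpoly ((A ^+ k *m v)^T *m pinvmx krylov)).
by rewrite rmorphB /= map_polyXn map_rVpoly -rE poly_rV_K // subKr.
Qed.

Lemma diag_mulmx_eq0 (R : idomainType) n (e : 'rV[R]_n) (w : 'cV[R]_n) :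
  (diag_mx e *m w == 0) = [forall j, (e 0 j == 0) || (w j 0 == 0)].
Proof.
have diagE j : (diag_mx e *m w) j 0 = e 0 j * w j 0 by rewrite mul_diag_mx mxE.
apply/eqP/forallP => [/colP ew0 j|ew0]; first by rewrite -mulf_eq0 -diagE ew0 mxE.
by apply/colP => j; rewrite diagE mxE; apply/eqP; rewrite mulf_eq0.
Qed.

Section Eigenbasis.

Variables (F : fieldType) (n : nat) (P : 'M[F]_n.+1) (d : 'rV[F]_n.+1).
Implicit Types (v : 'cV[F]_n.+1) (q : {poly F}).

(* [P *m v] lists the coordinates of [v] in the eigenbasis formed by the columns of [invmx P]. *)
Definition eigenvalue_support v : seq F :=
  undup [seq d 0 j | j <- enum 'I_n.+1 & (P *m v) j 0 != 0].

Lemma eigenvalue_supportP v x :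
  reflect (exists2 j, (P *m v) j 0 != 0 & x = d 0 j) (x \in eigenvalue_support v).
Proof.
rewrite mem_undup; apply: (iffP mapP) => -[j]; rewrite ?mem_filter => Pvj ->.
  by exists j => //; case/andP: Pvj.
by exists j; rewrite // mem_filter Pvj mem_enum.
Qed.

Hypothesis P_unit : P \in unitmx.

Lemma eigenvalue_support_neq_nil v : v != 0 -> eigenvalue_support v != [::].
Proof.
move=> v0; have [j Pvj] : exists j, (P *m v) j 0 != 0.
  apply/existsP; rewrite -negb_forall; apply: contra v0 => /forallP Pv0.
  rewrite -(mulKmx P_unit v) (_ : P *m v = 0) ?mulmx0 //.
  by apply/colP => j; rewrite [RHS]mxE; apply/eqP/Pv0.
have : d 0 j \in eigenvalue_support v by apply/eigenvalue_supportP; exists j.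
by case: eigenvalue_support.
Qed.

Variable A : 'M[F]_n.+1.
Hypothesis PA : P *m A = diag_mx d *m P.

Lemma eigenvalue_support_eigenvalue v : {subset eigenvalue_support v <= eigenvalue A}.
Proof.
move=> _ /eigenvalue_supportP[j _ ->]; apply/eigenvalueP; exists (row j P).
  by rewrite -row_mul PA mul_diag_mx; apply/rowP => i; rewrite !mxE.
apply/negP => /eqP Pj0; have := row_free_unit P; rewrite P_unit => /row_freeP[B PB].
have /rowP/(_ j) : row j (P *m B) = 0 by rewrite row_mul Pj0 mul0mx.
by rewrite PB !mxE eqxx => /eqP; rewrite oner_eq0.
Qed.

Lemma mulmx_horner_eigenbasis q :
  P *m horner_mx A q = diag_mx (map_mx (horner q) d) *m P.
Proof.
rewrite -horner_mx_diag -[diag_mx d](mulmxK P_unit) -PA horner_mx_uconj //.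
by rewrite mulmxKV.
Qed.

Lemma horner_mx_mulmx_eq0 v q :
  (horner_mx A q *m v == 0) = (\prod_(x <- eigenvalue_support v) ('X - x%:P) %| q).
Proof.
have -> : (horner_mx A q *m v == 0) = all (root q) (eigenvalue_support v).
  rewrite -(inj_eq (can_inj (mulKmx P_unit))) mulmx0 mulmxA mulmx_horner_eigenbasis -mulmxA.
  rewrite diag_mulmx_eq0; apply/forallP/allP => [Pv0 _ /eigenvalue_supportP[j Pvj ->]|q0 j].
    by have := Pv0 j; rewrite (negbTE Pvj) orbF mxE.
  have [//|Pvj] := eqVneq ((P *m v) j 0) 0; first by rewrite orbT.
  by rewrite mxE; apply/orP; left; apply/q0/eigenvalue_supportP; exists j.
apply/idP/idP => [q0|/dvdpP[r ->]].
  by rewrite uniq_roots_dvdp // uniq_rootsE undup_uniq.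
by apply/allP => x xs; rewrite rootM root_prod_XsubC xs orbT.
Qed.

Lemma exprmx_eigenbasisE k u w : (A ^+ k) u w = \sum_j invmx P u j * P j w * d 0 j ^+ k.
Proof.
have -> : A ^+ k = invmx P *m (diag_mx (map_mx (horner 'X^k) d) *m P).
  by rewrite -mulmx_horner_eigenbasis mulKmx // rmorphXn /= horner_mx_X.
rewrite mxE; apply: eq_bigr => j _; rewrite mul_diag_mx !mxE hornerXn.
by rewrite mulrCA mulrC.
Qed.

End Eigenbasis.

Lemma mulrn_gcdn_rpred (V : zmodType) (S : zmodClosed V) (x : V) g h :
  x *+ g \in S -> x *+ h \in S -> x *+ gcdn g h \in S.
Proof.
have [->|g_gt0] := posnP g; first by rewrite gcd0n.
move=> Sg Sh; have [u v uv _] := egcdnP h g_gt0.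
have -> : x *+ gcdn g h = x *+ g *+ u - x *+ h *+ v.
  by rewrite -!mulrnA (mulnC g) (mulnC h) uv mulrnDr addrC addKr.
by apply: rpredB; apply: rpredMn.
Qed.

Definition odd_multiple (R : pzRingType) (b x : R) :=
  exists2 m : int, odd `|m| & x = b * m%:~R.

Definition odd_differences (R : pzRingType) (b : R) (s t : seq R) :=
  {in s & t, forall x y, odd_multiple b (x - y)}.

Lemma odd_multiple1_prod (R : pzRingType) (I : eqType) (s : seq I) (F : I -> R) :
  {in s, forall i, odd_multiple 1 (F i)} -> odd_multiple 1 (\prod_(i <- s) F i).
Proof.
move=> odd_F; rewrite big_seq; elim/big_ind: _ => //; first by exists 1; rewrite ?mul1r.
move=> _ _ [k odd_k ->] [m odd_m ->]; exists (k * m); first by rewrite abszM oddM odd_k.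
by rewrite !mul1r rmorphM.
Qed.

Lemma odd_multiple_sqr (R : comPzRingType) (b x : R) :
  odd_multiple b x -> exists2 k, odd k & x ^+ 2 = b ^+ 2 *+ k.
Proof.
case=> m odd_m ->; exists (`|m| ^ 2)%N; first by rewrite oddX.
rewrite {1}[m]intEsign rmorphM /= rmorph_sign -pmulrn !exprMn sqrr_sign mul1r.
by rewrite -natrX mulr_natr.
Qed.

Lemma odd_multiple_dvdn (R : pzRingType) (b x : R) g h : (h %| g)%N -> odd g ->
  odd_multiple (b *+ g) x -> odd_multiple (b *+ h) x.
Proof.
move=> /dvdnP[k ->]; rewrite oddM => /andP[odd_k _] [m odd_m ->].
exists (k%:Z * m); first by rewrite abszM oddM odd_k.
by rewrite rmorphM /= mulrA -pmulrn mulr_natr -mulrnA mulnC.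
Qed.

Lemma odd_multiple_common_measure (R : pzRingType) (S : zmodClosed R) (b : R) (s : seq R) :
  s != [::] -> {subset s <= S} -> {in s, forall x, odd_multiple b x} ->
  exists g, [/\ odd g, b *+ g \in S & {in s, forall x, odd_multiple (b *+ g) x}].
Proof.
elim: s => // x s IH _ sS s_odd.
have [m odd_m xE] := s_odd x (mem_head _ _).
have x_abszE : x = (b *+ `|m|%N) * ((-1) ^+ (m < 0)%R).
  by rewrite xE {1}[m]intEsign mulrC rmorphM /= rmorph_sign mulrA -pmulrn mulr_natr.
have Sm : b *+ `|m|%N \in S.
  have := sS x (mem_head _ _).
  by rewrite x_abszE -signr_odd; case: odd; rewrite ?mulr1 ?mulrN1 ?rpredN.
have m_x : odd_multiple (b *+ `|m|%N) x.
  by exists ((-1) ^+ (m < 0)%R); rewrite ?rmorph_sign // abszX exp1n.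
have [s0|s0] := eqVneq s [::].
  by exists `|m|%N; split=> // y; rewrite s0 inE => /eqP ->.
have [||g [odd_g Sg s_g]] := IH s0.
- by move=> y ys; rewrite sS // inE ys orbT.
- by move=> y ys; apply: s_odd; rewrite inE ys orbT.
exists (gcdn `|m| g); split; first exact: dvdn_odd (dvdn_gcdl _ _) odd_m.
  exact: mulrn_gcdn_rpred.
move=> y; rewrite inE => /orP[/eqP ->|/s_g].
  exact: odd_multiple_dvdn (dvdn_gcdl _ _) odd_m m_x.
exact: odd_multiple_dvdn (dvdn_gcdr _ _) odd_g.
Qed.

Lemma sum_positive_multiple (V : nmodType) (I : eqType) (s : seq I) (c : V) (F : I -> V) :
  s != [::] -> {in s, forall i, exists2 k, (0 < k)%N & F i = c *+ k} ->
  exists2 k, (0 < k)%N & \sum_(i <- s) F i = c *+ k.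
Proof.
elim: s => // i s IH _ sF; have [k k0 Fi] := sF i (mem_head _ _).
have [->|s0] := eqVneq s [::]; first by exists k; rewrite // big_seq1.
have [|m m0 Fs] := IH s0; first by move=> j js; apply: sF; rewrite inE js orbT.
by exists (k + m)%N; rewrite ?addn_gt0 ?k0 // big_cons Fi Fs mulrnDr.
Qed.

Lemma sqr_common_measure_rat (K : numFieldType) (s t : seq K) (b : K) :
  s != [::] -> t != [::] ->
  \prod_(x <- s) ('X - x%:P) \is a polyOver rat_num ->
  \prod_(y <- t) ('X - y%:P) \is a polyOver rat_num ->
  odd_differences b s t -> b ^+ 2 \in rat_num.
Proof.
move=> s_neq_nil t_neq_nil s_rat t_rat odd_st.
have [|k k_gt0 sumE] := @sum_positive_multiple K _ s (b ^+ 2)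
    (fun x => \sum_(y <- t) (x - y) ^+ 2) s_neq_nil.
  move=> x xs; apply: sum_positive_multiple => // y yt.
  by have [k odd_k ->] := odd_multiple_sqr (odd_st x y xs yt); exists k; rewrite ?odd_gt0.
have k_neq0 : k%:R != 0 :> K by rewrite pnatr_eq0 -lt0n.
rewrite -(mulfK k_neq0 (b ^+ 2)) mulr_natr -sumE rpred_div ?rpred_nat //.
exact: sum_sqr_differences_rpred.
Qed.

Section IntegerMatrix.

Variables (K : numFieldType) (n : nat) (A : 'M[int]_n.+1).
Variables (P : 'M[K]_n.+1) (d : 'rV[K]_n.+1).
Implicit Types (u v w : 'cV[int]_n.+1) (b : K).

Local Notation "M ^K" := (map_mx intr M : 'M[K]_(_, _)) (at level 8, format "M ^K").
Local Notation support v := (eigenvalue_support P d v^K).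

Hypotheses (P_unit : P \in unitmx) (PA : P *m A^K = diag_mx d *m P).

Lemma eigenvalue_support_algint v : {subset support v <= algint}.
Proof.
move=> x /(eigenvalue_support_eigenvalue P_unit PA).
rewrite -topredE /= eigenvalue_root_char -map_char_poly => Ax.
by apply/algintP; exists (char_poly A); first exact: char_poly_monic.
Qed.

Lemma eigenvalue_support_poly_rat v :
  \prod_(x <- support v) ('X - x%:P) \is a polyOver rat_num.
Proof.
have ratr_intr m k (B : 'M[int]_(m, k)) : map_mx ratr (map_mx intr B) = B^K.
  by rewrite -map_mx_comp; apply: eq_map_mx => z /=; rewrite ratr_int.
have [|q|p ->] := @vec_minpoly_map _ _ (ratr : rat -> K) _ (map_mx intr A) (map_mx intr v)
    (\prod_(x <- support v) ('X - x%:P)).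
- exact: monic_prod_XsubC.
- by rewrite !ratr_intr; apply: horner_mx_mulmx_eq0 P_unit _ PA _ _.
- by apply/polyOverP => i; rewrite coef_map /=; apply/rat_numP; exists p`_i.
Qed.

(* The resultant [D] of the minimal polynomials of [u] and [w] is a combination of them over
   the algebraic integers. Evaluating it at [A] and applying it to [u], which is [w] modulo 2,
   shows that [D *: u] is divisible by 2. *)
Lemma eigenvalue_support_sqr_differences_not_odd u v w i :
  u = w + v *+ 2 -> odd `|u i 0| ->
  ~ {in support u & support w, forall x y, odd_multiple 1 ((x - y) ^+ 2)}.
Proof.
move=> uE odd_u odd_sqr.
have := prod_XsubC_bezout_over (@eigenvalue_support_algint u) (@eigenvalue_support_algint w).
set f := \prod_(x <- _) _; set h := \prod_(y <- support w) _.
set D := \prod_(x <- _) _ => -[U [V [_ V_algint UV]]].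
have fu : horner_mx A^K f *m u^K = 0 by apply/eqP; rewrite (horner_mx_mulmx_eq0 P_unit PA).
have hw : horner_mx A^K h *m w^K = 0 by apply/eqP; rewrite (horner_mx_mulmx_eq0 P_unit PA).
pose y := horner_mx A^K (V * h) *m v^K.
have Du : D *: u^K = y *+ 2.
  rewrite -mul_scalar_mx -(horner_mx_C A^K) -UV rmorphD !rmorphM mulmxDl -!mulmxA fu.
  rewrite mulmx0 add0r {1}uE !mulr2n !map_mxD !mulmxDr hw mulmx0 add0r.
  by rewrite /y rmorphM -mulmxA.
have y_algint : y i 0 \in algint.
  have int_mx m k (B : 'M[int]_(m, k)) : B^K \is a mxOver algint.
    by apply/mxOverP => j l; rewrite mxE rpred_int.
  suff /mxOverP : y \is a mxOver algint by [].
  apply: mxOverM => //; apply: horner_mxOver => //; apply: rpredM => //.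
  rewrite /h big_seq rpred_prod // => x /eigenvalue_support_algint.
  by rewrite polyOverXsubC.
have [m odd_m DE] : odd_multiple 1 (D ^+ 2).
  rewrite -prodrXl; apply: odd_multiple1_prod => x xu.
  by rewrite -prodrXl; apply: odd_multiple1_prod => z zw; apply: odd_sqr.
have yE : y i 0 ^+ 2 * 4 = (m * u i 0 ^+ 2)%:~R.
  have Dui : D * (u i 0)%:~R = y i 0 *+ 2.
    by have /colP/(_ i) := Du; rewrite mulmxnE mxE [X in D * X]mxE.
  transitivity ((y i 0 *+ 2) ^+ 2); first by ring.
  by rewrite -Dui exprMn DE mul1r rmorphM rmorphXn.
have [z zE] : exists z : int, y i 0 ^+ 2 = z%:~R.
  apply: rat_num_algint_int; last exact: rpredX.
  have four_neq0 : 4 != 0 :> K by rewrite pnatr_eq0.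
  by rewrite -[y i 0 ^+ 2](mulfK four_neq0) yE rpred_div ?rpred_int ?rpred_nat.
have : z * 4 = m * u i 0 ^+ 2 by apply: (@intr_inj K); rewrite -yE zE rmorphM.
by move/(congr1 (fun k => odd `|k|)); rewrite !abszM !oddM odd_m odd_u andbF.
Qed.

Lemma eigenvalue_support_intr_neq_nil v : v != 0 -> support v != [::].
Proof.
move=> v_neq0; apply: (eigenvalue_support_neq_nil d P_unit); apply: contra v_neq0.
by move=> /eqP/colP v0; apply/eqP/colP => i; apply: (@intr_inj K); have := v0 i; rewrite !mxE.
Qed.

Lemma eigenvalue_support_common_measure u w b : u != 0 -> w != 0 ->
  odd_differences b (support u) (support w) ->
  exists g, [/\ odd g, b *+ g \in algint &
    odd_differences (b *+ g) (support u) (support w)].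
Proof.
move=> u_neq0 w_neq0 odd_uw; pose diffs := [seq x - y | x <- support u, y <- support w].
have [|_ /allpairsP[[x y] /= [xu yw ->]]|_ /allpairsP[[x y] /= [xu yw ->]]|] :=
    @odd_multiple_common_measure _ algint b diffs.
- move: (eigenvalue_support_intr_neq_nil u_neq0) (eigenvalue_support_intr_neq_nil w_neq0).
  by rewrite -!size_eq0 size_allpairs muln_eq0 => /negbTE -> /negbTE ->.
- by rewrite rpredB ?(eigenvalue_support_algint xu) ?(eigenvalue_support_algint yw).
- exact: odd_uw.
- move=> g [odd_g g_algint odd_diffs]; exists g; split=> // x y xu yw.
  exact/odd_diffs/allpairs_f.
Qed.

Lemma sqr_common_measure_ge2 u v w i b :
  u = w + v *+ 2 -> w != 0 -> odd `|u i 0| -> 0 < b -> b \in algint ->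
  odd_differences b (support u) (support w) -> 2 <= b ^+ 2.
Proof.
move=> uE w_neq0 odd_u b_gt0 b_algint odd_uw.
have u_neq0 : u != 0 by apply: contraTneq odd_u => ->; rewrite mxE.
have [z zE] : exists z : int, b ^+ 2 = z%:~R.
  apply: rat_num_algint_int; last exact: rpredX.
  apply: (@sqr_common_measure_rat K (support u) (support w)) => //.
  - exact: eigenvalue_support_intr_neq_nil.
  - exact: eigenvalue_support_intr_neq_nil.
  - exact: eigenvalue_support_poly_rat.
  - exact: eigenvalue_support_poly_rat.
have z_gt0 : 0 < z by rewrite -(ltr0z K) -zE exprn_gt0.
suff even_z : ~~ odd `|z| by rewrite zE -[2]/(2%:~R) ler_int; lia.
apply/negP => odd_z; apply: (eigenvalue_support_sqr_differences_not_odd uE odd_u) => x y xu yw.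
have [k odd_k ->] := odd_multiple_sqr (odd_uw x y xu yw).
exists (z * k%:Z); first by rewrite abszM oddM odd_z.
by rewrite mul1r zE rmorphM /= -pmulrn mulr_natr.
Qed.

End IntegerMatrix.

Section UnitCircle.

Variable R : realType.
Implicit Types (x y : R) (m : int).

Definition cis x : R[i] := Complex (cos x) (sin x).

Lemma cisD x y : cis (x + y) = cis x * cis y.
Proof.
by rewrite /cis cosD sinD; apply/eqP; rewrite eq_complex /= eqxx; apply/eqP; ring.
Qed.

Lemma norm_cis x : `|cis x| = 1.
Proof. by rewrite normc_def /= cos2Dsin2 sqrtr1. Qed.

Lemma cis0 : cis 0 = 1.
Proof. by rewrite /cis cos0 sin0. Qed.

Lemma cisB x y : cis (x - y) = cis x / cis y.
Proof.
have cisy_neq0 : cis y != 0 by rewrite -normr_eq0 norm_cis oner_eq0.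
by apply: (mulIf cisy_neq0); rewrite divfK // -cisD subrK.
Qed.

Lemma cis_pi_int m : cis (pi * m%:~R) = (-1) ^+ `|m|.
Proof.
have cis_pi_nat k : cis (pi * k%:R) = (-1) ^+ k.
  elim: k => [|k IH]; first by rewrite mulr0 cis0.
  rewrite -natr1 mulrDr mulr1 cisD IH exprSr; congr (_ * _).
  by apply/eqP; rewrite eq_complex /= cospi sinpi oppr0 !eqxx.
case: m => k; first exact: cis_pi_nat.
by rewrite NegzE mulrNz mulrN -sub0r cisB cis0 cis_pi_nat abszN div1r invr_sign.
Qed.

Lemma cis_eqN1 x : cis x = -1 <-> odd_multiple pi x.
Proof.
have pi_gt0 := pi_gt0 R.
split=> [cisx|[m odd_m ->]]; last by rewrite cis_pi_int -signr_odd odd_m.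
pose m := Num.floor (x / pi); pose y := x - pi * m%:~R.
have y_ge0 : 0 <= y by rewrite subr_ge0 mulrC -ler_pdivlMr // floor_le.
have y_ltpi : y < pi.
  rewrite ltrBlDr -{1}[pi]mulr1 -mulrDr addrC -ltr_pdivrMl // mulrC.
  by have /andP[_] := floor_itv (x / pi); rewrite rmorphD.
have cisy : cis y = (-1) ^+ odd `|m|.+1.
  by rewrite cisB cisx cis_pi_int invr_sign signr_odd exprS.
have siny : sin y = 0.
  by rewrite -[LHS]/(complex.Im (cis y)) cisy; case: odd => /=; rewrite ?oppr0.
have y0 : y = 0.
  apply/eqP; rewrite eq_le y_ge0 andbT leNgt; apply/negP => y_gt0.
  by have := @sin_gt0_pi R y; rewrite y_gt0 y_ltpi siny ltxx => /(_ isT).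
exists m; last by apply/eqP; rewrite -subr_eq0 -/y y0.
have := congr1 (@complex.Re R) cisy; rewrite y0 /= cos0.
by case: (odd `|m|) => //= one_eqN1; lra.
Qed.

End UnitCircle.

Lemma limn_series_lincomb (K : numFieldType) (I : Type) (r : seq I) (c : I -> K)
    (u : I -> K^nat) :
  (forall i, cvgn (series (u i))) ->
  limn (series (fun k => \sum_(i <- r) c i * u i k)) = \sum_(i <- r) c i * limn (series (u i)).
Proof.
move=> cvg_u; apply/cvg_lim => //.
have -> : series (fun k => \sum_(i <- r) c i * u i k) =
    fun m => \sum_(i <- r) c i * series (u i) m.
  apply/funext => m; rewrite /series /= exchange_big /=.
  by apply: eq_bigr => i _; rewrite mulr_sumr.
elim: r => [|i r IH].
  by rewrite big_nil; under eq_fun do rewrite big_nil; exact: cvg_cst.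
rewrite big_cons; under eq_fun do rewrite big_cons.
by apply: cvgD => //; apply: cvgMl_tmp; apply: cvg_u.
Qed.

Local Notation "x %:C" := (real_complex _ x) : ring_scope.

Lemma expcoefE (R : realType) (t : R) k : expcoef t k = Complex (cos_coeff t k) (sin_coeff t k).
Proof.
have i_even m : 'i%C ^+ m.*2 = ((-1 : R) ^+ m)%:C.
  by rewrite -mul2n exprM sqr_i rmorphXn rmorphN1.
have -> : expcoef t k = 'i%C ^+ k * (t ^+ k / k`!%:R)%:C.
  by rewrite /expcoef exprMn -mulrA rmorphM fmorphV rmorph_nat rmorphXn.
have -> : cos_coeff t k = (~~ odd k)%:R * (-1) ^+ k./2 * (t ^+ k / k`!%:R).
  by rewrite /cos_coeff /= mulrA.
have -> : sin_coeff t k = (odd k)%:R * (-1) ^+ k.-1./2 * (t ^+ k / k`!%:R).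
  by rewrite /sin_coeff /= mulrA.
have [k_odd|k_even] := boolP (odd k);
  [have kE : k = k.-1./2.*2.+1 by lia | have kE : k = k./2.*2 by lia];
  rewrite {1}kE ?exprS i_even;
  by apply/eqP; rewrite eq_complex /=; apply/andP; split; apply/eqP; ring.
Qed.

Definition signed_pair (R : pzRingType) n (a b : 'I_n) (s : bool) : 'cV[R]_n :=
  delta_mx a 0 + (-1) ^+ s *: delta_mx b 0.

Lemma signed_pair1 (R : pzRingType) n (a b : 'I_n) s : a != b -> signed_pair R a b s a 0 = 1.
Proof. by move=> ab; rewrite !mxE eqxx (negbTE ab) mulr0 addr0. Qed.

Lemma signed_pair_neq0 (R : nzRingType) n (a b : 'I_n) s : a != b -> signed_pair R a b s != 0.
Proof.
move=> ab; apply/eqP => /colP/(_ a)/eqP.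
by rewrite signed_pair1 // mxE oner_eq0.
Qed.

Lemma map_signed_pair (R : pzRingType) n (a b : 'I_n) s :
  map_mx intr (signed_pair int a b s) = signed_pair R a b s.
Proof. by rewrite map_mxD map_mxZ !map_delta_mx rmorph_sign. Qed.

Section PerfectStateTransfer.

Variables (R : realType) (n : nat) (A P : 'M[R]_n.+1) (d : 'rV[R]_n.+1).
Implicit Types (a b : 'I_n.+1) (s : bool) (t : R).
Hypotheses (P_unit : P \in unitmx) (PA : P *m A = diag_mx d *m P).

Lemma limn_series_eigenbasis (c : R^nat) u v :
  (forall j, cvgn (series (fun k => c k * d 0 j ^+ k))) ->
  limn (series (fun k => c k * (A ^+ k) u v)) =
    \sum_j invmx P u j * P j v * limn (series (fun k => c k * d 0 j ^+ k)).
Proof.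
move=> cvg_c; rewrite -limn_series_lincomb //.
congr (limn (series _)); apply/funext => k.
by rewrite (exprmx_eigenbasisE P_unit PA) mulr_sumr; apply: eq_bigr => j _; rewrite mulrCA.
Qed.

Local Notation complex_mx := (map_mx (real_complex R)).

Lemma expitA_eigenbasis t :
  complex_mx P *m expitA A t = diag_mx (map_mx (fun x => cis (t * x)) d) *m complex_mx P.
Proof.
have cos_series j : (fun k => cos_coeff t k * d 0 j ^+ k) = cos_coeff (t * d 0 j).
  by apply/funext => k; rewrite /cos_coeff /= exprMn; ring.
have sin_series j : (fun k => sin_coeff t k * d 0 j ^+ k) = sin_coeff (t * d 0 j).
  by apply/funext => k; rewrite /sin_coeff /= exprMn; ring.
suff -> : expitA A t = complex_mx (invmx P) *m
    (diag_mx (map_mx (fun x => cis (t * x)) d) *m complex_mx P).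
  by rewrite mulmxA -map_mxM mulmxV // map_mx1 mul1mx.
apply/matrixP => u v; rewrite mxE.
under [X in limn (series X)]eq_fun do rewrite expcoefE /=.
under [X in Complex _ (limn (series X))]eq_fun do rewrite expcoefE /=.
rewrite !limn_series_eigenbasis; last first.
- by move=> j; rewrite cos_series; apply: is_cvg_series_cos_coeff.
- by move=> j; rewrite sin_series; apply: is_cvg_series_sin_coeff.
have cplxE (x y : R) : Complex x y = x%:C + 'i%C * y%:C by rewrite [LHS]complexE.
rewrite mxE cplxE !rmorph_sum mulr_sumr -big_split /=; apply: eq_bigr => j _.
rewrite mul_diag_mx !mxE cos_series sin_series.
by rewrite !rmorphM /cis cplxE cos.unlock sin.unlock; ring.
Qed.

Lemma pst_eigenbasis a b t :
  pst A a b t <-> exists2 gamma : R[i], `|gamma| = 1 &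
    forall j, cis (t * d 0 j) * (P j a)%:C = gamma * (P j b)%:C.
Proof.
have PC_unit : complex_mx P \in unitmx by rewrite map_unitmx.
have columnE gamma : (forall u, expitA A t u a = gamma * (u == b)%:R) <->
    forall j, cis (t * d 0 j) * (P j a)%:C = gamma * (P j b)%:C.
  transitivity (expitA A t *m delta_mx a 0 = gamma *: delta_mx b 0 :> 'cV_n.+1).
    rewrite -colE; split=> [expE|/colP expE u].
      by apply/colP => u; rewrite [LHS]mxE expE !mxE andbT.
    by have := expE u; rewrite [LHS]mxE => ->; rewrite !mxE andbT.
  transitivity (complex_mx P *m (expitA A t *m delta_mx a 0) =
                complex_mx P *m (gamma *: delta_mx b 0) :> 'cV_n.+1).
    by split=> [->|/(can_inj (mulKmx PC_unit))].
  rewrite mulmxA expitA_eigenbasis -mulmxA -scalemxAr -!colE mul_diag_mx.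
  split=> [/colP expE j|expE]; last by apply/colP => j; rewrite !mxE.
  by have := expE j; rewrite !mxE.
by split=> [[gamma [gamma1 /columnE]]|[gamma gamma1 /columnE]]; exists gamma => //.
Qed.

Local Notation support a b s := (eigenvalue_support P d (signed_pair R a b s)).

Lemma support_signed_pairP a b s x :
  reflect (exists2 j, P j a + (-1) ^+ s * P j b != 0 & x = d 0 j) (x \in support a b s).
Proof.
have coordE j : (P *m signed_pair R a b s) j 0 = P j a + (-1) ^+ s * P j b.
  by rewrite mulmxDr -scalemxAr -!colE !mxE.
by apply: (iffP (eigenvalue_supportP _ _ _ _)) => -[j Pj ->]; exists j; move: Pj; rewrite ?coordE.
Qed.

Lemma pst_supports a b t :
  pst A a b t <-> exists2 gamma : R[i], `|gamma| = 1 &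
    forall s, {in support a b s, forall x, cis (t * x) = (-1) ^+ s * gamma}.
Proof.
rewrite pst_eigenbasis; split=> -[gamma gamma1] cisP; exists gamma => //.
  move=> s _ /support_signed_pairP[j Pj ->].
  have norm_real (x : R) : `|x%:C| = `|x|%:C.
    by rewrite normc_def /= expr0n addr0 sqrtr_sqr.
  have : `|P j a| == `|P j b|.
    apply/eqP/complexI; rewrite -!norm_real.
    by have := congr1 Num.norm (cisP j); rewrite !normrM norm_cis gamma1 !mul1r.
  rewrite eqr_norm2 => Pab; have PabE : P j a = (-1) ^+ s * P j b.
    case: s Pj Pab => /=; rewrite ?mulN1r ?mul1r => Pj /orP[]/eqP // PE.
      by rewrite PE subrr eqxx in Pj.
    by rewrite PE addNr eqxx in Pj.
  have Pb : (P j b)%:C != 0.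
    by rewrite fmorph_eq0; apply: contraNneq Pj => Pb; rewrite PabE Pb mulr0 addr0.
  have := cisP j; rewrite PabE rmorphM rmorph_sign mulrA => /(mulIf Pb) <-.
  by rewrite mulrCA -expr2 sqrr_sign mulr1.
move=> j.
have cis_pairE s : cis (t * d 0 j) * ((P j a)%:C + (-1) ^+ s * (P j b)%:C) =
    (-1) ^+ s * gamma * ((P j a)%:C + (-1) ^+ s * (P j b)%:C).
  have -> : (P j a)%:C + (-1) ^+ s * (P j b)%:C = (P j a + (-1) ^+ s * P j b)%:C.
    by rewrite rmorphD rmorphM rmorph_sign.
  have [->|Pj] := eqVneq (P j a + (-1) ^+ s * P j b) 0; first by rewrite rmorph0 !mulr0.
  by rewrite (cisP s) //; apply/support_signed_pairP; exists j.
have two_neq0 : 2 != 0 :> R[i] by rewrite pnatr_eq0.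
apply: (mulfI two_neq0); have := cis_pairE false; have := cis_pairE true.
rewrite expr0 expr1 !mul1r => minusE plusE.
transitivity (gamma * ((P j a)%:C + (P j b)%:C) + -1 * gamma * ((P j a)%:C + -1 * (P j b)%:C)).
  by rewrite -plusE -minusE; ring.
by ring.
Qed.

Lemma pst_odd_differences a b t : a != b -> t != 0 ->
  pst A a b t <-> odd_differences (pi / t) (support a b false) (support a b true).
Proof.
move=> ab t_neq0; rewrite pst_supports.
have odd_cis x : odd_multiple (pi / t) x <-> cis (t * x) = -1.
  rewrite cis_eqN1; split=> -[m odd_m xE]; exists m => //.
    by rewrite xE; field.
  by apply: (mulfI t_neq0); rewrite xE; field.
split=> [[gamma gamma1 cisP] x y xp ym|odd_pm].
  have gamma_neq0 : gamma != 0 by rewrite -normr_eq0 gamma1 oner_eq0.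
  rewrite odd_cis mulrBr cisB (cisP _ _ xp) (cisP _ _ ym) mul1r mulN1r.
  by rewrite invrN mulrN divff.
have support_inhabited s : exists x, x \in support a b s.
  have := eigenvalue_support_neq_nil d P_unit (signed_pair_neq0 R s ab).
  by case: (support a b s) => // x r _; exists x; rewrite mem_head.
have [x0 x0p] := support_inhabited false; have [y0 y0m] := support_inhabited true.
have cis_pm x y : x \in support a b false -> y \in support a b true ->
    cis (t * x) = - cis (t * y).
  move=> xp ym; have /odd_cis := odd_pm x y xp ym.
  have -> : t * x = t * (x - y) + t * y by ring.
  by rewrite cisD => ->; rewrite mulN1r.
exists (cis (t * x0)); first exact: norm_cis.
case=> x x_supp; last by rewrite mul1r (cis_pm x y0) // (cis_pm x0 y0).
by rewrite (cis_pm x0 x) // mulN1r opprK.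
Qed.

End PerfectStateTransfer.

Lemma symmetric_int_mx_pst_early (R : realType) n (A : 'M[int]_n.+1) (a b : 'I_n.+1) (t : R) :
  A^T = A -> a != b -> 0 < t -> pst (map_mx intr A) a b t ->
  exists2 s : R, 0 < s <= pi / Num.sqrt 2 & pst (map_mx intr A) a b s.
Proof.
move=> symA ab t_gt0 pst_t; have pi_gt0 := pi_gt0 R.
have [|P P_unit /diagonalizable_forPex[d /(simmxP P_unit) PA]] :=
    @symmetric_diagonalizable R n (map_mx intr A); first by rewrite map_trmx symA.
pose u := signed_pair int a b false; pose w := signed_pair int a b true.
have uE : u = w + delta_mx b 0 *+ 2.
  by rewrite /u /w /signed_pair scale1r scaleN1r mulr2n addrA subrK.
have u_neq0 : u != 0 by apply: signed_pair_neq0.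
have w_neq0 : w != 0 by apply: signed_pair_neq0.
have pst_odd s : s != 0 -> pst (map_mx intr A) a b s <-> odd_differences (pi / s)
    (eigenvalue_support P d (map_mx intr u)) (eigenvalue_support P d (map_mx intr w)).
  by rewrite !map_signed_pair; apply: pst_odd_differences.
have /pst_odd odd_t := pst_t.
have [g [odd_g c_algint odd_c]] :=
  eigenvalue_support_common_measure P_unit PA u_neq0 w_neq0 (odd_t (lt0r_neq0 t_gt0)).
set c := pi / t *+ g in c_algint odd_c.
have c_gt0 : 0 < c by rewrite pmulrn_lgt0 ?odd_gt0 // divr_gt0.
have c_ge2 : 2 <= c ^+ 2.
  apply: (sqr_common_measure_ge2 (i := a) P_unit PA uE w_neq0 _ c_gt0 c_algint odd_c).
  by rewrite signed_pair1.
exists (pi / c).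
  rewrite divr_gt0 // ler_pM2l // lef_pV2 ?posrE ?sqrtr_gt0 //.
  by rewrite -[c]gtr0_norm // -sqrtr_sqr ler_wsqrtr.
apply/pst_odd; first by rewrite lt0r_neq0 ?divr_gt0.
by rewrite invf_div mulrCA divff ?mulr1 ?lt0r_neq0.
Qed.

Theorem theorem14 (R : realType) (n : nat) (e : rel 'I_n) (a b : 'I_n) (t : R) :
  simple_graph e -> a != b ->
  0 < t -> pst (adjmx R e) a b t ->
  (forall s : R, 0 < s -> s < t -> ~ pst (adjmx R e) a b s) ->
  t <= pi / Num.sqrt 2.
Proof.
case: n e a b => [e []//|n e a b] [sym_e _] ab t_gt0 pst_t t_min.
pose A : 'M[int]_n.+1 := \matrix_(i, j) (e i j)%:R.
have symA : A^T = A by apply/matrixP => i j; rewrite !mxE sym_e.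
have AE : adjmx R e = map_mx intr A by apply/matrixP => i j; rewrite !mxE rmorph_nat.
rewrite AE in pst_t t_min.
have [s /andP[s_gt0 s_le] pst_s] := symmetric_int_mx_pst_early symA ab t_gt0 pst_t.
apply: le_trans s_le; rewrite leNgt; apply/negP => s_lt_t.
exact: t_min s_gt0 s_lt_t pst_s.
Qed.
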